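(* Let $H$ and $G$ be graphs. If $H$ is a minor of $G$, then $\gamma(H)\leq\gamma(G)$, where $\gamma$ denotes the homological dimension.
   Context: All graphs are finite, simple and undirected, with at least one vertex. Minor: $H$ is a minor of $G$ if there exist pairwise disjoint connected subgraphs $G_v\subset G$, one for each vertex $v$ of $H$, such that for any adjacent vertices $u,v$ of $H$ there is an edge of $G$ connecting a vertex of $G_u$ to a vertex of $G_v$. Nerve: for a family of non-empty sets $\mathcal{F}=\{S_1,\dots,S_n\}$ the nerve is the simplicial complex $N(\mathcal{F})=\{\sigma\subset[n] : \bigcap_{i\in\sigma}S_i\neq\emptyset\}$ on the vertex set $[n]=\{1,\dots,n\}$. (Families are indexed; repeated members are allowed.) Connected cover: a connected cover in $G$ is a finite family $\mathcal{F}=\{G_1,\dots,G_n\}$ of (non-empty) induced subgraphs of $G$ such that $G_\sigma=\bigcap_{i\in\sigma}G_i$ is connected for every non-empty $\sigma\in N(\mathcal{F})$; the intersection of induced subgraphs is the subgraph induced by the intersection of their vertex sets, and the nerve is taken with respect to vertex sets. Homology: $\tilde H_i(K)$ is the $i$-th reduced homology group of a simplicial complex $K$ with coefficients in $\mathbb{Z}_2$. Homological dimension: $\gamma(G)$ is the greatest integer $d$ such that $\tilde H_d(N(\mathcal{F}))\neq 0$ for some connected cover $\mathcal{F}$ in $G$; for the one-vertex graph $K_1$ one sets $\gamma(K_1)=-1$. *)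

(* Defs.v *)
From HB Require Import structures.
From mathcomp Require Import all_boot all_order all_algebra.
From mathcomp Require classical_sets.

Set Implicit Arguments.
Unset Strict Implicit.
Unset Printing Implicit Defensive.

Import GRing.Theory.
Local Open Scope ring_scope.

Record sgraph := SGraph {
  vertex :> finType;
  adj : rel vertex;
  adj_sym : symmetric adj;
  adj_irrefl : irreflexive adj;
  vertex_gt0 : (0 < #|vertex|)%N }.

Record subgraph (G : sgraph) := Subgraph {
  sverts : {set G};
  sedge : rel G;
  sedge_sym : symmetric sedge;
  sedge_sub : forall x y, sedge x y ->
    [&& adj x y, x \in sverts & y \in sverts] }.

Definition connected_subgraph (G : sgraph) (S : subgraph G) : Prop :=
  sverts S != set0 /\ {in sverts S &, forall x y, connect (sedge S) x y}.

Definition induced_edge (G : sgraph) (W : {set G}) : rel G :=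
  [rel x y | [&& adj x y, x \in W & y \in W]].

Lemma induced_edge_sym (G : sgraph) (W : {set G}) : symmetric (induced_edge W).
Proof. by move=> x y; rewrite /induced_edge /= adj_sym andbCA andbC -andbA andbCA. Qed.

Definition induced (G : sgraph) (W : {set G}) : subgraph G :=
  Subgraph (@induced_edge_sym G W) (fun x y exy => exy).

Definition minor (H G : sgraph) : Prop :=
  exists B : H -> subgraph G,
    [/\ forall v, connected_subgraph (B v),
        forall u v, u != v -> [disjoint sverts (B u) & sverts (B v)]
      & forall u v, adj u v ->
          exists x y, [/\ x \in sverts (B u), y \in sverts (B v) & adj x y]].

(* A simplicial complex K on the vertex set I is the set of its simplices, the
   empty one included, and its chains (over Z/2) are the functions from subsets
   of I to 'F_2 that vanish outside the simplices of the given dimension. *)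

Definition chain (I : finType) : vectType 'F_2 := {ffun {set I} -> ('F_2)^o}.

Definition simplex_chain (I : finType) (s : {set I}) : chain I :=
  [ffun t => (t == s)%:R].

Definition faces (I : finType) (K : {set {set I}}) (d : int) : {set {set I}} :=
  [set s in K | #|s|%:Z == d + 1].

(* The empty simplex spans degree -1, so for d = 0 the boundary below is the
   augmentation map. *)
Definition chains (I : finType) (K : {set {set I}}) (d : int) :
    {vspace chain I} :=
  <<[seq simplex_chain s | s <- enum (faces K d)]>>%VS.

Definition boundary_fun (I : finType) (c : chain I) : chain I :=
  \sum_(s : {set I}) c s *: \sum_(i in s) simplex_chain (s :\ i).

Definition boundary (I : finType) : 'End(chain I) := linfun (@boundary_fun I).

Definition cycles (I : finType) (K : {set {set I}}) (d : int) :
    {vspace chain I} :=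
  (chains K d :&: lker (boundary I))%VS.

Definition boundaries (I : finType) (K : {set {set I}}) (d : int) :
    {vspace chain I} :=
  (boundary I @: chains K (d + 1)%R)%VS.

Definition boundaries_in_cycles (I : finType) (K : {set {set I}}) (d : int) :
    {vspace subvs_of (cycles K d)} :=
  (linfun vsval @^-1: boundaries K d)%VS.

Definition homology (I : finType) (K : {set {set I}}) (d : int) : zmodType :=
  Quotient.quot (boundaries_in_cycles K d).

Definition homology_nonzero (I : finType) (K : {set {set I}}) (d : int) : Prop :=
  exists x : homology K d, x != 0.

(* For s = set0 the intersection is the whole ambient type, so the empty
   simplex belongs to the nerve as soon as V is inhabited. *)
Definition nerve (I V : finType) (F : I -> {set V}) : {set {set I}} :=
  [set s : {set I} | \bigcap_(i in s) F i != set0].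

(* An induced subgraph is given by its vertex set; the union of the members
   need not be all of G. *)
Definition connected_cover (G : sgraph) (n : nat) (F : 'I_n -> {set G}) : Prop :=
  (forall i, F i != set0) /\
  (forall s, s \in nerve F -> s != set0 ->
     connected_subgraph (induced (\bigcap_(i in s) F i))).

(* The family may be empty (n = 0). Its nerve is then [set set0], with homology
   in degree -1 only, which does not affect gamma. *)
Definition cover_homology (G : sgraph) (d : int) : Prop :=
  exists (n : nat) (F : 'I_n -> {set G}),
    connected_cover F /\ homology_nonzero (nerve F) d.

Definition greatest (P : int -> Prop) (d : int) : Prop :=
  P d /\ forall d', P d' -> d' <= d.

(* Repeating members of a family does not change the homology of its nerve, so
   the degrees in question are bounded; the default value of xget is not used. *)
Definition gamma (G : sgraph) : int :=
  if #|G| == 1%N then -1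
  else classical_sets.xget (-1) (greatest (cover_homology G)).

(* Main.v *)
From HB Require Import structures.
Require Import Defs.
From mathcomp Require Import all_boot all_order all_algebra.
From mathcomp Require boolp classical_sets.
From mathcomp Require Import zify.
Local Open Scope ring_scope.

(** Let [B v] be the branch sets of a model of [H] in [G].  A connected cover
[F] of [H] is transported to [G] by replacing each member [F i] with the union
[blowup B (F i)] of the branch sets of its vertices.  As the branch sets are
pairwise disjoint and non-empty, [blowup] commutes with non-empty intersections
and preserves non-emptiness, so the new family has the same nerve
([nerve_blowup]); as they are connected, and joined by an edge whenever their
indices are adjacent, [blowup] preserves connectedness ([blowup_connected]).
Hence each degree in which a connected cover of [H] has non-zero homology is
also such a degree for [G] ([minor_cover_homology]).

To compare the greatest such degrees one must know that the greatest one
exists for [G], although the covers have unbounded size.  The nerve of a family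
of subsets of [V] is the union, over the vertices [v] of [V], of the full
simplices on [{i | v \in F i}].  A union of [m] full simplices has no homology
in degrees [k >= m] ([covered_exact]): this is the Mayer-Vietoris argument, by
induction on [m], since the intersection of one of the simplices with the union
of the others is a union of [m - 1] full simplices.  So the degrees lie between
[-1] and [#|V| - 1] ([nerve_homology_degree]). *)

Set Implicit Arguments.
Unset Strict Implicit.
Unset Printing Implicit Defensive.

Import Order.TTheory GRing.Theory Num.Theory.

(** * Chains and their boundaries *)

Section Boundary.
Variable I : finType.
Implicit Types (c b : chain I) (s t : {set I}) (T : {set I}).

(** Chains take values in the regular module over ['F_2]; their coefficients are
read in ['F_2] itself, so that they can be multiplied. *)
Lemma chainDE c b s : (c + b) s = (c s : 'F_2) + (b s : 'F_2) :> 'F_2.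
Proof. by rewrite ffunE. Qed.

Lemma chainNE c s : (- c) s = - (c s : 'F_2) :> 'F_2.
Proof. by rewrite ffunE. Qed.

Lemma chainZE (a : 'F_2) c s : (a *: c) s = a * (c s : 'F_2) :> 'F_2.
Proof. by rewrite [LHS]ffunE. Qed.

Lemma chain_sumE (J : finType) (P : pred J) (f : J -> chain I) s :
  (\sum_(j | P j) f j) s = \sum_(j | P j) (f j s : 'F_2) :> 'F_2.
Proof. exact: sum_ffunE. Qed.

Lemma boundary_fun_linear : linear (@boundary_fun I).
Proof.
move=> a c b; rewrite /boundary_fun scaler_sumr -big_split /=.
by apply: eq_bigr => s _; rewrite !ffunE scalerDl scalerA.
Qed.

HB.instance Definition _ :=
  GRing.isLinear.Build _ _ _ _ (@boundary_fun I) boundary_fun_linear.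

Lemma boundaryE c t : boundary I c t = \sum_(i | i \notin t) (c (i |: t) : 'F_2) :> 'F_2.
Proof.
rewrite lfunE /= /boundary_fun chain_sumE.
transitivity (\sum_(s : {set I}) \sum_(i in s)
    (c s : 'F_2) * (simplex_chain (s :\ i) t : 'F_2)).
  by apply: eq_bigr => s _; rewrite -mulr_sumr -chain_sumE -chainZE.
rewrite (exchange_big_dep predT) //= [RHS]big_mkcond; apply: eq_bigr => i _.
under eq_bigr => s _ do rewrite ffunE.
case: ifPn => it.
  rewrite (bigD1 (i |: t)) ?setU11 //= setU1K // eqxx big1 ?addr0.
    by rewrite mulr1.
  move=> s /andP[si neq]; case: eqP => [ts|_]; last by rewrite mulr0.
  by case/negP: neq; rewrite ts setD1K.
rewrite big1 // => s si; case: eqP => [ts|_]; last by rewrite mulr0.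
by case/negP: it; rewrite ts setD11.
Qed.

Lemma F2_opp (x : 'F_2) : - x = x.
Proof. by apply: (@oppr_pchar2 'F_2); rewrite pchar_Fp. Qed.

(** The ordered pairs [(i, j)] of distinct vertices added to [t] cancel in
opposite pairs, the coefficients being in characteristic 2. *)
Lemma boundaryK c : boundary I (boundary I c) = 0.
Proof.
apply/ffunP => t; rewrite boundaryE ffunE.
under eq_bigr => i _ do rewrite boundaryE.
pose P (i j : I) := [&& i \notin t, j \notin t & i != j].
pose lt (i j : I) := (enum_rank i < enum_rank j)%N.
pose S (Q : rel I) := \sum_(p : I * I | P p.1 p.2 && Q p.1 p.2)
  (c (p.2 |: (p.1 |: t)) : 'F_2).
have -> : \sum_(i | i \notin t) \sum_(j | j \notin i |: t) (c (j |: (i |: t)) : 'F_2)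
   = S (fun _ _ => true).
  rewrite pair_big_dep /=; apply: eq_bigl => -[i j] /=.
  by rewrite /P !inE negb_or eq_sym andbT; case: (i \in t); rewrite //= andbC.
have -> : S (fun _ _ => true) = S lt + S (fun i j => ~~ lt i j).
  rewrite /S (bigID (fun p : I * I => lt p.1 p.2)) /=.
  by congr (_ + _); apply: eq_bigl => p; rewrite andbT.
suff -> : S (fun i j => ~~ lt i j) = S lt by rewrite -{2}[S lt]F2_opp subrr.
rewrite /S (reindex_inj (h := fun p : I * I => (p.2, p.1))) /=; last first.
  by move=> [i j] [k l] [-> ->].
apply: eq_big => [[i j]|[i j] _] /=; last by rewrite setUCA.
rewrite /P /lt; case: (i \in t) => //=; case: (j \in t) => //=.
rewrite eq_sym; case: eqVneq => //= ne.
rewrite -leqNgt leq_eqVlt; case: eqP => // e.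
by rewrite (enum_rank_inj (val_inj e)) eqxx in ne.
Qed.

(** The chain [c] is supported on those sets of [k] vertices that satisfy [K],
i.e. it is a chain of degree [k - 1] of [K]. *)
Definition supported (K : pred {set I}) (k : nat) c : Prop :=
  forall s, c s != 0 -> K s && (#|s| == k).

Lemma supportedD K k c b :
  supported K k c -> supported K k b -> supported K k (c + b).
Proof.
move=> hc hb s; rewrite chainDE => nz.
case: (eqVneq (c s) 0) => [c0|]; last exact: hc.
by apply: hb; apply: contra_neq nz => b0; rewrite c0 b0 addr0.
Qed.

Lemma supportedN K k c : supported K k c -> supported K k (- c).
Proof. by move=> hc s; rewrite chainNE oppr_eq0; apply: hc. Qed.

Lemma supportedW (K L : pred {set I}) k c :
  subpred K L -> supported K k c -> supported L k c.
Proof. by move=> KL hc s /hc /andP[/KL-> ->]. Qed.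

Lemma supported_boundary (K : pred {set I}) k c :
  (forall s t, t \subset s -> K s -> K t) ->
  supported K k.+1 c -> supported K k (boundary I c).
Proof.
move=> Kdown hc t; rewrite boundaryE => nz.
have [i /andP[it ci]] : exists i, (i \notin t) && (c (i |: t) != 0).
  apply/existsP; apply: contraNT nz => /existsPn h.
  by rewrite big1 // => i it; move: (h i); rewrite it negbK => /eqP.
have /andP[Ki] := hc _ ci; rewrite cardsU1 it add1n eqSS => ->.
by rewrite (Kdown _ _ _ Ki) // subsetUr.
Qed.

(** * Unions of full simplices *)

(** The homology of [K] vanishes in degree [k] (a simplex of degree [k] has
[k.+1] vertices). *)
Definition exact_in (K : pred {set I}) (k : nat) : Prop :=
  forall c, supported K k.+1 c -> boundary I c = 0 ->
  exists2 b, supported K k.+2 b & boundary I b = c.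

(** A non-empty full simplex is a cone over any of its vertices [v]; the empty
one has no simplices in degrees [k >= 0]. *)
Lemma simplex_exact T k : exact_in (fun s => s \subset T) k.
Proof.
move=> c hc dc.
have [T0|[v vT]] := set_0Vmem T.
  exists 0; rewrite ?linear0.
    by move=> s; rewrite ffunE eqxx.
  apply/ffunP => s; rewrite ffunE; apply/eqP/negPn; apply/negP.
  rewrite eq_sym => /hc; rewrite T0 subset0 => /andP[/eqP->].
  by rewrite cards0.
(* The cone with apex v over the part of c that avoids v. *)
exists [ffun s : {set I} => if v \in s then c (s :\ v) else 0].
  move=> s; rewrite ffunE; case: ifP; rewrite ?eqxx // => vs /hc /andP[sT /eqP cs].
  rewrite (cardsD1 v) vs cs eqxx andbT -(setD1K vs).
  by apply/subsetP => x /setU1P[->//|]; apply/subsetP.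
apply/ffunP => t; rewrite boundaryE.
under eq_bigr => i _ do rewrite ffunE in_setU1.
case: (boolP (v \in t)) => vt.
  under eq_bigr => i _ do rewrite orbT.
  have := congr1 (fun f : chain I => f (t :\ v)) dc.
  rewrite boundaryE ffunE (bigD1 v) ?setD11 //= setD1K // => /eqP.
  rewrite addr_eq0 F2_opp => /eqP ->.
  apply: eq_big => [i|i it].
    by rewrite !inE; case: eqVneq => [->|]; rewrite ?vt ?andbF ?andbT.
  congr (c _); apply/setP => x; rewrite !inE; case: (eqVneq x i) => // ->.
  by rewrite orTb andbT; apply: contraNneq it => ->.
rewrite (bigD1 v) //= eqxx setU1K // big1 ?addr0 // => i /andP[_ /negPf ne].
by rewrite eq_sym ne.
Qed.

(** The union of the full simplices on the members of [r], the empty simplex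
included unless [r] is empty. *)
Definition covered (r : seq {set I}) : pred {set I} :=
  fun s => has (fun T => s \subset T) r.

Lemma covered_down r s t : t \subset s -> covered r s -> covered r t.
Proof.
by move=> ts; apply: sub_has => T; apply: subset_trans.
Qed.

(** The intersection of a union of full simplices with the full simplex on
[T]. *)
Lemma covered_meet r T s :
  covered [seq U :&: T | U <- r] s = covered r s && (s \subset T).
Proof.
rewrite /covered has_map; elim: r => //= U r ->.
by rewrite subsetI andb_orl.
Qed.

(** Mayer-Vietoris: a cycle of [T :: r] is [c1 + c2] with [c1] in the union of
[r] and [c2] in the simplex [T]; the common boundary of [c1] and [c2] bounds a
chain [w] in the intersection, and both [c1 - w] and [c2 + w] are cycles. *)
Lemma covered_exact r k : (size r <= k)%N -> exact_in (covered r) k.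
Proof.
move: {2}(size r) (leqnn (size r)) => m.
elim: m r k => [|m IH] [|T r] // k; last 1 first.
- rewrite /= ltnS => rm; case: k => // k; rewrite ltnS => rk c hc dc.
  pose c1 : chain I := [ffun s => if covered r s then c s else 0].
  pose c2 := c - c1.
  have cE : c = c1 + c2 by rewrite addrC subrK.
  have h1 : supported (covered r) k.+2 c1.
    by move=> s; rewrite ffunE; case: ifP; rewrite ?eqxx // => rs /hc /andP[_ ->].
  have h2 : supported (fun s => s \subset T) k.+2 c2.
    move=> s; rewrite chainDE chainNE ffunE.
    case: ifPn; rewrite ?subrr ?eqxx // => rs.
    by rewrite subr0 => /hc /=; rewrite (negPf rs) orbF.
  have d12 : boundary I c1 = - boundary I c2.
    by apply/eqP; rewrite -addr_eq0 -linearD /= -cE dc.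
  have [] := IH [seq U :&: T | U <- r] k _ _ (boundary I c1).
  + by rewrite size_map.
  + by rewrite size_map.
  + move=> s nz; rewrite covered_meet.
    have /andP[-> ->] := supported_boundary (@covered_down r) h1 nz.
    rewrite d12 chainNE oppr_eq0 in nz.
    have down : forall s t, t \subset s -> s \subset T -> t \subset T.
      by move=> ? ?; apply: subset_trans.
    by have /andP[-> _] := supported_boundary down h2 nz.
  + exact: boundaryK.
  move=> w hw dw.
  have [] := IH r k.+1 rm (leqW rk) (c1 - w).
  + apply: supportedD => //; apply: supportedN; apply: supportedW hw => s.
    by rewrite covered_meet => /andP[].
  + by rewrite linearB /= dw subrr.
  move=> b1 hb1 db1.
  have [] := @simplex_exact T k.+1 (c2 + w).
  + apply: supportedD => //; apply: supportedW hw => s.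
    by rewrite covered_meet => /andP[].
  + by rewrite linearD /= dw d12 subrr.
  move=> b2 hb2 db2; exists (b1 + b2).
    apply: supportedD.
    + by apply: supportedW hb1 => s /= rs; apply/orP; right.
    + by apply: supportedW hb2 => s /= ->.
  by rewrite linearD /= db1 db2 addrACA addNr addr0 -cE.
all: move=> _ _ c hc _; exists 0; rewrite ?linear0; first by move=> s; rewrite ffunE eqxx.
all: apply/ffunP => s; rewrite ffunE; apply/eqP/negPn; apply/negP.
all: by rewrite eq_sym => /hc.
Qed.

(** * Homology of nerves *)

Lemma chains_supported (K : {set {set I}}) (d : int) c :
  c \in chains K d -> forall s, c s != 0 -> s \in faces K d.
Proof.
rewrite /chains => cK s; apply: contraNT => sK.
rewrite (coord_span (X := in_tuple _) cK) chain_sumE big1 // => j _.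
rewrite chainZE; set e : chain I := (in_tuple _)`_j; suff -> : e s = 0 by rewrite mulr0.
have : e \in [seq simplex_chain s | s <- enum (faces K d)] by exact: mem_nth.
case/mapP => t; rewrite mem_enum => tK ->; rewrite ffunE; case: eqP => // st.
by rewrite st tK in sK.
Qed.

Lemma supported_chains (K : {set {set I}}) (d : int) c :
  (forall s, c s != 0 -> s \in faces K d) -> c \in chains K d.
Proof.
move=> hc; have -> : c = \sum_s c s *: simplex_chain s.
  apply/ffunP => t; rewrite chain_sumE (bigD1 t) //= big1 => [|s st].
    by rewrite chainZE ffunE eqxx addr0 mulr1.
  by rewrite chainZE ffunE eq_sym (negPf st) mulr0.
apply: memv_suml => s _; have [->|/hc sK] := eqVneq (c s) 0.
  by rewrite scale0r mem0v.
by apply/memvZ/memv_span/map_f; rewrite mem_enum.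
Qed.

Lemma homology_vanishes (K : {set {set I}}) (d : int) :
  (cycles K d <= boundaries K d)%VS -> ~ homology_nonzero K d.
Proof.
move=> /subvP sub [x]; suff -> : x = 0 by rewrite eqxx.
have pi0 : \pi_(homology K d)%qT 0 = 0 :> homology K d by rewrite piE.
rewrite -[x]reprK -pi0; apply/eqP; rewrite -Quotient.idealrBE subr0.
rewrite -memv_preim lfunE /=; apply: sub; exact: subvsP.
Qed.

End Boundary.

(** The maximal simplices of a nerve are among the sets of indices of the
members through a given vertex. *)
Lemma nerveE (n : nat) (V : finType) (F : 'I_n -> {set V}) (s : {set 'I_n}) :
  (s \in nerve F) = covered [seq [set i | v \in F i] | v <- enum V] s.
Proof.
rewrite inE /covered has_map; apply/set0Pn/hasP => [[v /bigcapP h]|[v _ /subsetP h]].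
  by exists v; rewrite ?mem_enum //=; apply/subsetP => i /h; rewrite inE.
by exists v; apply/bigcapP => i /h; rewrite inE.
Qed.

Lemma nerve_homology_degree (n : nat) (V : finType) (F : 'I_n -> {set V})
    (d : int) :
  homology_nonzero (nerve F) d -> -1 <= d < #|V|%:Z.
Proof.
move=> nz; apply/negP => /negP dout; apply: homology_vanishes nz.
have hs c : c \in chains (nerve F) d -> forall s, c s != 0 ->
    (s \in nerve F) && (#|s|%:Z == d + 1).
  by move=> /chains_supported h s /h; rewrite inE.
apply/subvP => c; rewrite memv_cap memv_ker => /andP[/hs cd /eqP dc].
have [dneg|dge] := ltP d (-1).
  suff -> : c = 0 by rewrite mem0v.
  apply/ffunP => s; rewrite ffunE; apply/eqP/negPn; apply/negP.
  by move=> /cd /andP[_]; lia.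
have [k dk kV] : exists2 k : nat, d = k%:Z & (#|V| <= k)%N.
  by exists `|d|%N; lia.
have [||b hb <-] := @covered_exact _ [seq [set i | v \in F i] | v <- enum V] k
    _ c _ dc.
- by rewrite size_map -cardE.
- by move=> s /cd /andP[]; rewrite nerveE => -> /=; lia.
apply: memv_img; apply: supported_chains => s /hb /andP[].
by rewrite -nerveE => sN cs; rewrite inE sN (eqP cs) dk /=; lia.
Qed.

(** * Transport of connected covers along a minor *)

Section Minor.
Variables (H G : sgraph) (B : H -> subgraph G).
Hypothesis B_connected : forall v, connected_subgraph (B v).
Hypothesis B_disjoint :
  forall u v, u != v -> [disjoint sverts (B u) & sverts (B v)].
Hypothesis B_adj : forall u v, adj u v ->
  exists x y, [/\ x \in sverts (B u), y \in sverts (B v) & adj x y].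

(** The union of the branch sets of the vertices in [W]. *)
Definition blowup (W : {set H}) : {set G} := \bigcup_(v in W) sverts (B v).

Lemma mem_branch_eq u v x : x \in sverts (B u) -> x \in sverts (B v) -> u = v.
Proof.
move=> xu xv; apply/eqP; apply: contraTT xv => /B_disjoint dis.
by rewrite (disjointFr dis).
Qed.

Lemma mem_blowup W v x : x \in sverts (B v) -> (x \in blowup W) = (v \in W).
Proof.
move=> xv; apply/bigcupP/idP => [[u uW xu]|vW]; last by exists v.
by rewrite (mem_branch_eq xv xu).
Qed.

Lemma blowup_eq0 W : (blowup W == set0) = (W == set0).
Proof.
apply/eqP/eqP => [W0|->]; last by rewrite /blowup big_set0.
apply/setP => v; rewrite in_set0; have [/set0Pn[x xv] _] := B_connected v.
by rewrite -(mem_blowup W xv) W0 in_set0.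
Qed.

Lemma blowup_bigcap (I : finType) (F : I -> {set H}) (s : {set I}) :
  s != set0 -> \bigcap_(i in s) blowup (F i) = blowup (\bigcap_(i in s) F i).
Proof.
move=> /set0Pn[i0 i0s]; apply/setP => x; apply/bigcapP/bigcupP => [h|].
  have /bigcupP[v _ xv] := h i0 i0s; exists v => //.
  by apply/bigcapP => i /h; rewrite (mem_blowup _ xv).
by case=> v /bigcapP h xv i /h; rewrite (mem_blowup _ xv).
Qed.

Lemma blowup_connected W :
  connected_subgraph (induced W) -> connected_subgraph (induced (blowup W)).
Proof.
case=> /= W0 conn; split=> /=; first by rewrite blowup_eq0.
have in_branch v x y : v \in W -> x \in sverts (B v) -> y \in sverts (B v) ->
    connect (induced_edge (blowup W)) x y.
  move=> vW xv yv; have [_ /(_ x y xv yv)] := B_connected v.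
  apply: connect_sub => a b /sedge_sub /and3P[ab av bv].
  by apply: connect1; rewrite /induced_edge /= ab (mem_blowup _ av) (mem_blowup _ bv) vW.
move=> x y /bigcupP[u uW xu] /bigcupP[v vW yv].
have /connectP[p] := conn u v uW vW.
elim: p u uW x xu => [|w p IH] u uW x xu /= => [_ ev|].
  by rewrite ev in yv vW; apply: in_branch yv.
case/andP=> /and3P[uw _ wW] pw ev.
have [a [b [au bw ab]]] := B_adj uw.
apply: connect_trans (in_branch _ _ _ uW xu au) _.
apply: connect_trans (IH w wW b bw pw ev).
by apply: connect1; rewrite /induced_edge /= ab (mem_blowup _ au) (mem_blowup _ bw) uW.
Qed.

Lemma nerve_blowup (I : finType) (F : I -> {set H}) :
  nerve (fun i => blowup (F i)) = nerve F.
Proof.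
apply/setP => s; rewrite !inE; have [->|s0] := eqVneq s set0.
  by rewrite !big_set0 -!card_gt0 !cardsT !vertex_gt0.
by rewrite blowup_bigcap // blowup_eq0.
Qed.

Lemma connected_cover_blowup (n : nat) (F : 'I_n -> {set H}) :
  connected_cover F -> connected_cover (fun i => blowup (F i)).
Proof.
case=> F0 Fconn; split=> [i|s]; first by rewrite blowup_eq0.
by rewrite nerve_blowup => sN s0; rewrite blowup_bigcap //; apply/blowup_connected/Fconn.
Qed.

Lemma card_branches : (#|H| <= #|G|)%N.
Proof.
have ne v : exists x, x \in sverts (B v).
  by have [/set0Pn] := B_connected v.
apply: (@leq_card _ _ (fun v => xchoose (ne v))) => u v e.
by apply: mem_branch_eq (xchooseP (ne u)) _; move: e => /= ->; apply: xchooseP.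
Qed.

End Minor.

Lemma minor_card (H G : sgraph) : minor H G -> (#|H| <= #|G|)%N.
Proof. by case=> B [Bc Bd _]; apply: (card_branches Bc Bd). Qed.

Lemma minor_cover_homology (H G : sgraph) (d : int) :
  minor H G -> cover_homology H d -> cover_homology G d.
Proof.
case=> B [Bc Bd Ba] [n [F [Fc nz]]].
exists n, (fun i => blowup B (F i)); split.
  exact: connected_cover_blowup.
by rewrite nerve_blowup.
Qed.

Lemma cover_homology_degree (G : sgraph) (d : int) :
  cover_homology G d -> -1 <= d < #|G|%:Z.
Proof. by case=> n [F [_ /nerve_homology_degree]]. Qed.

(** * Comparison of the homological dimensions *)

Lemma greatest_exists (P : int -> Prop) (u d : int) :
  (forall e, P e -> e < u) -> P d -> exists e, greatest P e.
Proof.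
move=> Pb; have [m] := ubnP `|u - d|%N; elim: m d => // m IH d lem Pd.
have [[e Pe de]|no] := boolp.pselect (exists2 e, P e & d < e).
  by apply: (IH e) => //; have := Pb _ Pe; have := Pb _ Pd; lia.
exists d; split=> // e Pe; rewrite leNgt; apply/negP => de.
by apply: no; exists e.
Qed.

(** This holds whether or not [gamma] takes its default value. *)
Lemma gamma_ge_N1 (G : sgraph) : -1 <= gamma G.
Proof.
rewrite /gamma; case: ifP => // _.
by case: classical_sets.xgetP => // d _ [/cover_homology_degree /andP[]].
Qed.

Lemma cover_homology_le_gamma (G : sgraph) (d : int) :
  #|G| != 1%N -> cover_homology G d -> d <= gamma G.
Proof.
rewrite /gamma => /negPf -> Pd.
have Pb e : cover_homology G e -> e < #|G|%:Z.
  by case/cover_homology_degree/andP.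
by have := greatest_exists Pb Pd; move=> /(@classical_sets.xgetPex _ (-1)) [_]; apply.
Qed.

Theorem theorem2p1 (H G : sgraph) : minor H G -> gamma H <= gamma G.
Proof.
move=> mHG; rewrite {1}/gamma; case: ifPn => H1; first exact: gamma_ge_N1.
case: classical_sets.xgetP => [d _ [Pd _]|_]; last exact: gamma_ge_N1.
apply: cover_homology_le_gamma (minor_cover_homology mHG Pd).
(* If G has only one vertex then so does H. *)
apply: contra_neq H1 => G1; apply/eqP.
by rewrite eqn_leq -{1}G1 minor_card //= vertex_gt0.
Qed.
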